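(* Let $n$ and $\ell$ be positive integers with $\frac{n}{2}\leq \ell\leq n-3$. Then $$t(n,3,\ell)\leq 2n-\ell-1.$$
   Context: All graphs are finite, undirected and simple. Let $G$ be a nontrivial connected graph of order $n$ (i.e. with $n$ vertices). An edge-coloring of $G$ is any assignment of colors to the edges (adjacent edges may receive the same color). A tree $T$ that is a subgraph of $G$ is a rainbow tree if no two edges of $T$ have the same color. For $S\subseteq V(G)$ with $|S|\geq 2$, a rainbow $S$-tree is a rainbow tree $T$ in $G$ with $S\subseteq V(T)$. For an integer $k$ with $2\leq k\leq n$, an edge-coloring of $G$ is a $k$-rainbow coloring if for every $k$-subset $S$ of $V(G)$ there exists a rainbow $S$-tree. The $k$-rainbow index $rx_k(G)$ is the minimum number of colors needed in a $k$-rainbow coloring of $G$. For integers $2\leq k\leq n$ and $2\leq\ell\leq n-1$, $t(n,k,\ell)$ denotes the minimum size (number of edges) of a connected graph $G$ of order $n$ with $rx_k(G)\leq \ell$ (when such a graph exists). *)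

(* Defs.v *)
From mathcomp Require Import all_boot.

Set Implicit Arguments.
Unset Strict Implicit.
Unset Printing Implicit Defensive.

Record sgraph := SGraph {
  vertex :> finType;
  adj : rel vertex;
  adj_sym : symmetric adj;
  adj_irrefl : irreflexive adj }.

(* An edge is the two-element set of its ends. *)
Definition edges (G : sgraph) : {set {set G}} :=
  [set [set p.1; p.2] | p : G * G & adj p.1 p.2].

Definition connected (G : sgraph) : Prop :=
  forall x y : G, connect (@adj G) x y.

(* The pair (V, F) of a set of vertices and a set of edges is a subgraph. *)
Definition is_subgraph (G : sgraph) (V : {set G}) (F : {set {set G}}) : Prop :=
  F \subset edges G /\ (forall e, e \in F -> e \subset V).

Definition edge_rel (G : sgraph) (F : {set {set G}}) : rel G :=
  fun x y => [set x; y] \in F.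

(* [ucycle] also accepts the empty sequence and a two-vertex sequence that goes
   back and forth along one edge, hence the bound on the size. *)
Definition acyclic (G : sgraph) (F : {set {set G}}) : Prop :=
  ~ exists s : seq G, 2 < size s /\ ucycle (edge_rel F) s.

Definition is_tree (G : sgraph) (V : {set G}) (F : {set {set G}}) : Prop :=
  [/\ is_subgraph V F, V != set0,
      {in V &, forall x y, connect (edge_rel F) x y} & acyclic F].

(* The values of a coloring outside [edges G] are never used. *)
Definition coloring (G : sgraph) : Type := {set G} -> nat.

Definition num_colors (G : sgraph) (c : coloring G) : nat :=
  size (undup [seq c e | e <- enum (edges G)]).

Definition rainbow_tree (G : sgraph) (c : coloring G)
    (V : {set G}) (F : {set {set G}}) : Prop :=
  is_tree V F /\ {in F &, injective c}.

Definition rainbow_coloring (G : sgraph) (k : nat) (c : coloring G) : Prop :=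
  forall S : {set G}, #|S| = k ->
    exists V F, rainbow_tree c V F /\ S \subset V.

Definition is_min (P : nat -> Prop) (m : nat) : Prop :=
  P m /\ forall i, P i -> m <= i.

(* [is_rx G k r] states rx_k(G) = r. *)
Definition is_rx (G : sgraph) (k r : nat) : Prop :=
  is_min (fun i => exists c : coloring G,
    rainbow_coloring k c /\ num_colors c = i) r.

(* [is_t n k l t] states that t(n,k,l) is defined and equal to t. *)
Definition is_t (n k l t : nat) : Prop :=
  is_min (fun i => exists G : sgraph,
    [/\ #|G| = n, connected G, (exists r, is_rx G k r /\ r <= l)
      & #|edges G| = i]) t.

(* Main.v *)
(** Write k = n - l, so that 3 <= k <= l.  Take a star with hub 0 and leaves
1, ..., n-1, and add the k edges of a cycle (the rim) through the leaves
1, ..., k.  The spokes to the rim get the colors 1, ..., k and the other l - 1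
spokes the colors 1, ..., l-1, so that only the spokes to i and k + i share a
color.  The rim gets color l: a tree containing both i and k + i then
reaches i through one of its two rim neighbors.  If k = l, color l is also that
of a spoke, and the two rim edges at the vertex l get the colors 1 and 3
instead, which works for l >= 4.  The remaining case l = k = 3 is settled by
K_{2,4}. *)

Require Import Defs.
From mathcomp Require Import all_boot.
From mathcomp Require Import zify.
From Stdlib Require Import Classical.

Set Implicit Arguments.
Unset Strict Implicit.
Unset Printing Implicit Defensive.

(** * Minima of predicates, edges, and the one-vertex tree *)

Lemma is_min_exists (P : nat -> Prop) m : P m -> exists r, is_min P r /\ r <= m.
Proof.
elim/ltn_ind: m => m IH Pm.
(* [P] need not be decidable, so the descent to a smaller value uses excluded middle. *)
have [[i [Pi lt_im]]|noP] := classic (exists i, P i /\ i < m).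
  have [r [Pr le_ri]] := IH i lt_im Pi.
  by exists r; split=> //; apply: leq_trans le_ri (ltnW lt_im).
exists m; split=> //; split=> // i Pi; rewrite leqNgt.
by apply/negP => lt_im; apply: noP; exists i.
Qed.

Lemma set2_eqP (T : finType) (a b x y : T) :
  [set a; b] = [set x; y] -> (a = x /\ b = y) \/ (a = y /\ b = x).
Proof.
move=> eq2.
have : a \in [set x; y] by rewrite -eq2 set21.
have : b \in [set x; y] by rewrite -eq2 set22.
have : x \in [set a; b] by rewrite eq2 set21.
have : y \in [set a; b] by rewrite eq2 set22.
rewrite !inE => /pred2P[] ? /pred2P[] ? /pred2P[] ? /pred2P[] ?; subst; auto.
Qed.

Lemma edges_set2 (G : sgraph) (x y : G) : ([set x; y] \in edges G) = adj x y.
Proof.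
apply/imsetP/idP => [[p + /set2_eqP[[-> ->]|[-> ->]]]|adj_xy]; rewrite ?inE //.
  by rewrite adj_sym.
by exists (x, y); rewrite ?inE.
Qed.

Lemma edge_rel_sym (G : sgraph) (F : {set {set G}}) : symmetric (edge_rel F).
Proof. by move=> x y; rewrite /edge_rel setUC. Qed.

Lemma rainbow_tree1 (G : sgraph) (c : coloring G) (x : G) :
  rainbow_tree c [set x] set0.
Proof.
split; last by move=> e e'; rewrite inE.
split.
- by split; [exact: sub0set | move=> e; rewrite inE].
- by apply/set0Pn; exists x; rewrite set11.
- by move=> a b /set1P-> /set1P->; apply: connect0.
case=> [[|a s] [//= _ /andP[cyc _]]]; move: cyc.
by case: s => [|b s] /=; rewrite /edge_rel inE.
Qed.

(** * Hanging a leaf [y] on a vertex [x] of a rainbow tree *)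

Section AddLeaf.

Variables (G : sgraph) (V : {set G}) (F : {set {set G}}) (x y : G).
Hypotheses (xV : x \in V) (yV : y \notin V) (FV : forall e, e \in F -> e \subset V).

Let F' := [set x; y] |: F.

Lemma edge_rel_leaf z : edge_rel F' y z -> z = x.
Proof.
rewrite /edge_rel in_setU1 => /orP[/eqP /set2_eqP[[yx]|[_]]|/FV] //.
  by move: yV; rewrite yx xV.
by rewrite subUset sub1set (negPf yV).
Qed.

(** A cycle avoiding [y] already lies in [F]. In a cycle rotated to start at [y], the second and the
    last vertex are both [x], the only neighbor of [y], so [x] would occur twice. *)
Lemma acyclic_add_leaf : acyclic F -> acyclic F'.
Proof.
move=> acF [s [s_gt2 /andP[cyc_s uniq_s]]].
have [ys|yNs] := boolP (y \in s); last first.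
  apply: acF; exists s; split=> //; apply/andP; split=> //.
  apply: (sub_in_cycle (P := predC1 y)) cyc_s.
    move=> a b; rewrite !inE => aNy bNy.
    rewrite /edge_rel in_setU1 => /orP[/eqP /set2_eqP[[_ e]|[e _]]|//].
      by rewrite e eqxx in bNy.
    by rewrite e eqxx in aNy.
  by apply/allP => a sa /=; apply: contraNneq yNs => <-.
have [i p def_s] := rot_to ys.
move: cyc_s uniq_s s_gt2; rewrite -(rot_cycle i) -(rot_uniq i) -(size_rot i) def_s.
case: p def_s => [|a [|b p]] //= _ /and3P[ya _].
rewrite rcons_path => /andP[_]; rewrite edge_rel_sym => ylast.
case/and3P=> _ + _ _; rewrite (edge_rel_leaf ya) -(edge_rel_leaf ylast).
by rewrite mem_last.
Qed.

Lemma connected_add_leaf :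
  {in V &, forall a b, connect (edge_rel F) a b} ->
  {in y |: V &, forall a b, connect (edge_rel F') a b}.
Proof.
move=> conV.
have sym : connect_sym (edge_rel F').
  by apply: sym_connect_sym; apply: edge_rel_sym.
have to_x a : a \in y |: V -> connect (edge_rel F') a x.
  case/setU1P=> [->|aV]; first by apply: connect1; rewrite edge_rel_sym /edge_rel setU11.
  apply: (connect_sub _ (conV a x aV xV)) => b d bd.
  by apply: connect1; rewrite /edge_rel in_setU1 [X in _ || X]bd orbT.
by move=> a b /to_x ax /to_x; rewrite sym; apply: connect_trans.
Qed.

Lemma rainbow_tree_add_leaf (c : coloring G) :
  adj x y -> {in F, forall e, c e != c [set x; y]} ->
  rainbow_tree c V F -> rainbow_tree c (y |: V) F'.
Proof.
move=> adj_xy newc [[[FE _] _ conV acF] injc]; split.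
  split; [split | | exact: connected_add_leaf | exact: acyclic_add_leaf].
  - by rewrite subUset sub1set edges_set2 adj_xy.
  - move=> e /setU1P[->|/FV eV]; last exact: subset_trans eV (subsetUr _ _).
    by rewrite subUset !sub1set setU11 setU1r.
  by apply/set0Pn; exists y; rewrite setU11.
move=> e e' /setU1P[->|eF] /setU1P[->|e'F] //; last exact: injc.
  by move=> eqc; case/eqP: (newc _ e'F).
by move=> eqc; case/eqP: (newc _ eF).
Qed.

End AddLeaf.

(** * Graphs on 0, ..., n-1 with checkable descriptions of rainbow trees *)

Section NatGraph.

Variables (n : nat) (r : rel nat) (r_sym : symmetric r) (r_irr : irreflexive r).
Variables (g : nat -> nat -> nat) (g_sym : forall x y, g x y = g y x).

Definition nat_graph : sgraph :=
  @SGraph 'I_n (fun x y => r x y) (fun x y => r_sym x y) (fun x => r_irr x).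

(** The ends are recovered from the edge in an arbitrary order, which is harmless because [g] is
    symmetric. *)
Definition nat_coloring : coloring nat_graph := fun e =>
  if [pick p : nat_graph * nat_graph | e == [set p.1; p.2]] is Some p
  then g p.1 p.2 else 0.

Lemma nat_coloring_set2 (x y : nat_graph) :
  nat_coloring [set x; y] = g (x : 'I_n) (y : 'I_n).
Proof.
rewrite /nat_coloring; case: pickP => [p /eqP /set2_eqP[[-> ->]|[-> ->]]|noP] //.
by have := noP (x, y); rewrite /= eqxx.
Qed.

(* The steps [(x, y)] of [s] hang a leaf y on the vertex x of a tree with vertex
   list [V] and color list [C]; steps to a vertex already present are ignored. *)
Fixpoint growth (V C : seq nat) (s : seq (nat * nat)) : bool :=
  if s is (x, y) :: s' then
    ((y \in V) || [&& x \in V, y < n, r x y & g x y \notin C])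
    && growth (y :: V) (g x y :: C) s'
  else true.

(** [C] need only contain the colors of [F]: an ignored step still records its color, which merely
    makes the later checks stricter. *)
Lemma growth_rainbow_tree V C s (U : {set nat_graph}) F :
    rainbow_tree nat_coloring U F ->
    (forall x : 'I_n, (x \in U) = (val x \in V)) ->
    (forall x, x \in V -> x < n) ->
    (forall e, e \in F -> nat_coloring e \in C) -> growth V C s ->
  exists U' F', rainbow_tree nat_coloring U' F'
    /\ forall x : 'I_n, val x \in V ++ unzip2 s -> x \in U'.
Proof.
elim: s V C U F => [|[x y] s IH] V C U F tF UV Vn FC /=.
  by move=> _; exists U, F; split=> // x; rewrite cats0 UV.
case/andP=> step /IH{}IH.
have in_cons z : (z \in V ++ y :: unzip2 s) = (z \in (y :: V) ++ unzip2 s).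
  by rewrite /= !(mem_cat, inE) orbCA.
have [yV|yNV] := boolP (y \in V).
  have [| | |U' [F' [tF' U'P]]] := IH U F tF.
  - by move=> z; rewrite inE UV; case: eqP => [->|].
  - by move=> z; rewrite inE => /predU1P[->|]; apply: Vn.
  - by move=> e /FC; rewrite inE orbC => ->.
  by exists U', F'; split=> // z; rewrite in_cons; apply: U'P.
rewrite (negPf yNV) /= in step; case/and4P: step => xV lt_yn rxy gC.
pose x' : nat_graph := Ordinal (Vn x xV); pose y' : nat_graph := Ordinal lt_yn.
have col_xy : nat_coloring [set x'; y'] = g x y by apply: nat_coloring_set2.
have [[[[_ FU] _ _ _] _]] := (tF).
have xU : x' \in U by rewrite UV.
have yU : y' \notin U by rewrite UV.
have tF1 : rainbow_tree nat_coloring (y' |: U) ([set x'; y'] |: F).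
  apply: rainbow_tree_add_leaf => // e /FC; rewrite col_xy => eC.
  by apply: contraNneq gC => <-.
have [| | |U' [F' [tF' U'P]]] := IH _ _ tF1.
- by move=> z; rewrite !inE UV.
- by move=> z; rewrite inE => /predU1P[->|]; [|apply: Vn].
- move=> e /setU1P[->|/FC]; first by rewrite col_xy mem_head.
  by rewrite inE orbC => ->.
by exists U', F'; split=> // z; rewrite in_cons; apply: U'P.
Qed.

(** The three vertices may coincide, so this yields connectedness as well as 3-rainbow colorings. *)
Definition spans3 : Prop := forall x y z, x < n -> y < n -> z < n ->
  exists v s, [/\ v < n, growth [:: v] [::] s
    & {subset [:: x; y; z] <= v :: unzip2 s}].

Hypothesis sp3 : spans3.

Lemma spans3_rainbow_tree (x y z : nat_graph) :
  exists U F, rainbow_tree nat_coloring U F /\ [/\ x \in U, y \in U & z \in U].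
Proof.
have [v [s [lt_vn gs subs]]] := sp3 (ltn_ord x) (ltn_ord y) (ltn_ord z).
have [| | |U [F [tF UP]]] := growth_rainbow_tree
  (rainbow_tree1 nat_coloring (Ordinal lt_vn : nat_graph)) _ _ _ gs.
- by move=> a; rewrite !inE.
- by move=> a; rewrite inE => /eqP->.
- by move=> e; rewrite inE.
exists U, F; split=> //.
by split; apply: UP; apply: subs; rewrite !inE eqxx ?orbT.
Qed.

Lemma spans3_connected : connected nat_graph.
Proof.
move=> x y; have [U [F [[[[FE _] _ conU _] _] [xU yU _]]]] := spans3_rainbow_tree x y y.
apply: (connect_sub _ (conU x y xU yU)) => a b /(subsetP FE).
by rewrite edges_set2; apply: connect1.
Qed.

Lemma spans3_rainbow_coloring : rainbow_coloring 3 nat_coloring.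
Proof.
move=> S card_S.
have [x [y [z defS]]] : exists x y z, S = [set x; y; z].
  move/eqP: card_S; rewrite cardE; case defE: (enum S) => [|x [|y [|z []]]] // _.
  by exists x, y, z; apply/setP => a; rewrite -mem_enum defE !inE orbA.
have [U [F [tF [xU yU zU]]]] := spans3_rainbow_tree x y z.
exists U, F; split=> //; rewrite defS.
by apply/subsetP => a; rewrite !inE => /orP[/pred2P[]|/eqP] ->.
Qed.

Lemma num_colors_nat_coloring l :
    (forall x y, x < n -> y < n -> r x y -> 0 < g x y <= l) ->
  num_colors nat_coloring <= l.
Proof.
move=> g_bound; rewrite /num_colors -[leqRHS](size_iota 1).
apply: uniq_leq_size; first exact: undup_uniq.
move=> i; rewrite mem_undup => /mapP[e]; rewrite mem_enum.
case/imsetP=> -[x y]; rewrite inE /= => rxy -> ->.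
by rewrite nat_coloring_set2 mem_iota add1n ltnS g_bound.
Qed.

Lemma card_edges_nat_graph (L : seq (nat * nat)) :
    (forall x y, x < y -> y < n -> r x y -> (x, y) \in L) ->
  #|edges nat_graph| <= size L.
Proof.
move=> L_edges.
(* An edge provides a vertex, hence the default value that [insubd] needs. *)
have [->|[e0 /imsetP[p _ _]]] := set_0Vmem (edges nat_graph); first by rewrite cards0.
have n_gt0 : 0 < n by apply: leq_ltn_trans (ltn_ord p.1).
pose toV i : nat_graph := insubd (Ordinal n_gt0) i.
rewrite cardE -(size_map (fun p => [set toV p.1; toV p.2]) L).
apply: uniq_leq_size; first exact: enum_uniq.
move=> e; rewrite mem_enum => /imsetP[[x y] + ->]; rewrite inE /= => rxy.
wlog lt_xy : x y rxy / val x < val y.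
  move=> W; case: (ltngtP (val x) (val y)) => [lt_xy|lt_yx|/val_inj eq_xy].
  - exact: W lt_xy.
  - by rewrite setUC; apply: W lt_yx; rewrite r_sym.
  by move: rxy; rewrite eq_xy r_irr.
apply/mapP; exists (val x, val y); first exact: L_edges rxy.
by rewrite /toV /= !valKd.
Qed.

Lemma is_t_nat_graph l (L : seq (nat * nat)) :
    (forall x y, x < n -> y < n -> r x y -> 0 < g x y <= l) ->
    (forall x y, x < y -> y < n -> r x y -> (x, y) \in L) ->
  exists t, is_t n 3 l t /\ t <= size L.
Proof.
move=> g_bound L_edges.
have [|t [t_min t_le]] := @is_min_exists (fun i => exists G : sgraph,
  [/\ #|G| = n, connected G, (exists q, is_rx G 3 q /\ q <= l)
    & #|edges G| = i]) #|edges nat_graph|.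
  exists nat_graph; split=> //; [exact: card_ord | exact: spans3_connected |].
  have [|q [q_min q_le]] := @is_min_exists (fun i => exists c : coloring nat_graph,
    rainbow_coloring 3 c /\ num_colors c = i) (num_colors nat_coloring).
    by exists nat_coloring; split=> //; apply: spans3_rainbow_coloring.
  by exists q; split=> //; apply: leq_trans q_le (num_colors_nat_coloring g_bound).
by exists t; split=> //; apply: leq_trans t_le (card_edges_nat_graph L_edges).
Qed.

End NatGraph.

(** * The star with a rim, for l >= 4 *)

Section Wheel.

Variables k l : nat.

Definition wheel_adj : rel nat := fun x y =>
  (x != y) && [|| x == 0, y == 0 |
    [&& x <= k, y <= k & [|| y == x.+1, x == y.+1,
      (x == 1) && (y == k) | (x == k) && (y == 1)]]].

Definition spoke_color x := if x <= k then x else x - k.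

(** A rim edge reaches the middle branch only if k = l, since rim vertices are at most k. *)
Definition wheel_color x y :=
  if (x == 0) || (y == 0) then spoke_color (x + y)
  else if (x == l) || (y == l) then if (x == 1) || (y == 1) then 3 else 1
  else l.

Lemma wheel_adj_sym : symmetric wheel_adj.
Proof. by move=> x y; rewrite /wheel_adj; lia. Qed.

Lemma wheel_adj_irr : irreflexive wheel_adj.
Proof. by move=> x; rewrite /wheel_adj eqxx. Qed.

Lemma wheel_color_sym x y : wheel_color x y = wheel_color y x.
Proof.
by rewrite /wheel_color addnC [(x == 0) || _]orbC [(x == l) || _]orbC [(x == 1) || _]orbC.
Qed.

Hypotheses (k_ge3 : 2 < k) (le_kl : k <= l) (l_ge4 : 3 < l).

Lemma wheel_color_bound x y : x < k + l -> y < k + l -> wheel_adj x y ->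
  0 < wheel_color x y <= l.
Proof.
rewrite /wheel_adj /wheel_color /spoke_color => ? ?.
by repeat case: ifP => ?; lia.
Qed.

(** The edge closing the rim, the n-1 spokes, and the other k-1 rim edges. *)
Definition wheel_edges : seq (nat * nat) :=
  (1, k) :: [seq (0, y) | y <- iota 1 (k + l).-1] ++ [seq (x, x.+1) | x <- iota 1 k.-1].

Lemma wheel_edgesP x y : x < y -> y < k + l -> wheel_adj x y ->
  (x, y) \in wheel_edges.
Proof.
move=> lt_xy lt_y; rewrite /wheel_adj inE mem_cat => adj_xy.
have [x0|x_gt0] := posnP x.
  by rewrite x0 map_f ?orbT // mem_iota; lia.
have [->|y_neq] := eqVneq y x.+1.
  by rewrite (map_f (fun x => (x, x.+1))) ?orbT // mem_iota; lia.
by rewrite xpair_eqE; lia.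
Qed.

Lemma wheel_adj_hub x : wheel_adj 0 x = (0 < x).
Proof. by rewrite /wheel_adj; lia. Qed.

Lemma spoke_color_rim i : i <= k -> spoke_color i = i.
Proof. by rewrite /spoke_color => ->. Qed.

Lemma spoke_color_pendant i : 0 < i -> spoke_color (k + i) = i.
Proof. by rewrite /spoke_color; case: ifP; lia. Qed.

Lemma wheel_color_hub x : wheel_color 0 x = spoke_color x.
Proof. by []. Qed.

Lemma wheel_color_rim x y : 0 < x -> 0 < y -> x != l -> y != l -> wheel_color x y = l.
Proof. by rewrite /wheel_color !lt0n => /negPf-> /negPf-> /negPf-> /negPf->. Qed.

(** The spoke to [k + i] uses color [i], so [i] must be reached along the rim. The conclusion lists
    the color conditions for the tree formed by the spokes to [k + i], [h], [j] and the edge [h i].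
    If [j] is a rim neighbor of [i], take h = j; otherwise the spoke color of [j] rules out at most
    one of the two neighbors. *)
Lemma rim_neighbor i j : 0 < i -> i <= k -> i < l ->
    ~~ [&& k == l, j == l, 1 < i & i.+1 < l] -> j < k + l ->
  exists h, [/\ wheel_adj h i, 0 < h <= k, (h == j) || (h != spoke_color j)
    & [/\ wheel_color h i != i, wheel_color h i != h &
       (h == j) || (wheel_color h i != spoke_color j)]].
Proof.
move=> i_gt0 le_ik lt_il jNl lt_j.
have [/and3P[adj_ji j_gt0 le_jk]|Nadj] := boolP [&& wheel_adj j i, 0 < j & j <= k].
  exists j; rewrite eqxx j_gt0; split=> //.
  have [j_l|j_neq_l] := eqVneq j l.
    move: adj_ji; rewrite /wheel_adj /wheel_color j_l eqxx.
    by repeat case: ifP; move=> *; split; lia.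
  by rewrite wheel_color_rim; [split; lia|lia..].
(* A spoke of color l forces j = k = l; the excluded case then leaves i = 1 or i = l-1, both
   adjacent to [j] on the rim. *)
have b_lt_l : spoke_color j < l.
  by move: Nadj; rewrite /wheel_adj /spoke_color; case: ifP; lia.
move: (spoke_color j) b_lt_l => b b_lt_l.
have [h [adj_hi h_k h_b h_l]] : exists h, [/\ wheel_adj h i, 0 < h <= k, h != b
    & h = l -> (i = 1 /\ b = 2) \/ (i = l.-1 /\ b = l.-2)].
  (* The predecessor of [i] if available, else its cyclic successor, except that k replaces 2 when i
     = 1 and b = 2. Where h = l, the edge has color 3 with i = 1, b = 2, or color 1 with i = l-1, b
     = l-2; both avoid i, b and l as l >= 4. *)
  exists (if (1 < i) && (b != i.-1) then i.-1 else if i == k then 1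
          else if (i == 1) && (b == 2) then k else i.+1).
  by rewrite /wheel_adj; repeat case: ifP; split; lia.
exists h; rewrite adj_hi h_k h_b orbT; split=> //.
have [h_eq_l|h_neq_l] := eqVneq h l.
  have := h_l h_eq_l; rewrite /wheel_color h_eq_l eqxx.
  by repeat case: ifP; move=> *; split; lia.
by rewrite wheel_color_rim; [split; lia|lia..].
Qed.

(* Except in the first case, i hangs on a rim neighbor h, possibly h = j.  The
   exception is k = l = j not adjacent to i: then the spoke to j and the rim edges
   at i have color l, and j hangs on its rim neighbor l - 1. *)
Lemma wheel_growth i j : 0 < i -> i <= k -> i < l -> j < k + l ->
  exists s, growth (k + l) wheel_adj wheel_color [:: 0] [::] s
    /\ {subset [:: i; k + i; j] <= 0 :: unzip2 s}.
Proof.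
move=> i_gt0 le_ik lt_il lt_j.
have [/and4P[/eqP k_l /eqP j_l lt1i lt_i]|jNl] :=
    boolP [&& k == l, j == l, 1 < i & i.+1 < l].
  have adj_succ x : 0 < x -> x < k -> wheel_adj x x.+1 by rewrite /wheel_adj; lia.
  have col_l : wheel_color l.-1 l = 1 by rewrite /wheel_color; repeat case: ifP; lia.
  have adj_l : wheel_adj l.-1 l by rewrite /wheel_adj; lia.
  (* The colors are i, l-1, 1, i+1, l in this order; if i+1 = l-1, the fourth step is ignored. *)
  exists [:: (0, k + i); (0, l.-1); (l.-1, l); (0, i.+1); (i.+1, i)].
  split; last by move=> x /=; rewrite !inE; lia.
  rewrite /= !inE !wheel_color_hub spoke_color_pendant // !spoke_color_rim; [|lia..].
  rewrite col_l (@wheel_color_rim i.+1 i) ?wheel_adj_hub; [|lia..].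
  by rewrite adj_l wheel_adj_sym adj_succ //; lia.
have [h [adj_hi /andP[h_gt0 le_hk] h_j [col_i col_h col_j]]] :=
  rim_neighbor i_gt0 le_ik lt_il jNl lt_j.
have h_i : h != i by apply: contraTneq adj_hi => ->; rewrite wheel_adj_irr.
have [ki_gt0 lt_ki lt_h lt_i] : [/\ 0 < k + i, k + i < k + l, h < k + l & i < k + l].
  by clear -i_gt0 le_ik lt_il le_hk; split; lia.
exists [:: (0, k + i); (0, h); (h, i); (0, j)]; split; last first.
  by move=> x /=; rewrite !inE => /or3P[] /eqP->; rewrite eqxx ?orbT.
rewrite /= !inE !wheel_color_hub spoke_color_pendant // (spoke_color_rim le_hk).
rewrite adj_hi !wheel_adj_hub ki_gt0 lt_ki h_gt0 lt_h h_i lt_i lt_j !eqxx.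
rewrite (negPf col_i) (negPf col_h) /= !orbT /=.
have [->|j_neq_h] := eqVneq j h; first by rewrite orbT.
move: h_j col_j; rewrite [h == j]eq_sym (negPf j_neq_h) /= ![_ == spoke_color j]eq_sym.
move=> /negPf-> /negPf-> /=; have [->|j_gt0] := posnP j; first by rewrite !orbT.
(* Only [i] and [k + i] have spoke color [i], and both are already in the tree. *)
have [j_i|_] := eqVneq (spoke_color j) i; last by rewrite !orbT.
have [->|->] : j = i \/ j = k + i.
- by clear -j_i; move: j_i; rewrite /spoke_color; case: ifP; lia.
- by rewrite eqxx.
by rewrite eqxx !orbT.
Qed.

(** If two of the vertices are i and k + i, [wheel_growth] applies; otherwise their spokes have
    distinct colors and form a rainbow star at the hub. *)
Lemma wheel_spans3 : spans3 (k + l) wheel_adj wheel_color.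
Proof.
move=> x y z lt_x lt_y lt_z.
pose clash a b := [&& 0 < a, a <= k & b == k + a].
have [[a [b [c [sub_abc clash_ab lt_b lt_c]]]]|no_clash] := classic (exists a b c,
    [/\ {subset [:: x; y; z] <= [:: a; b; c]}, clash a b, b < k + l & c < k + l]).
  case/and3P: clash_ab lt_b sub_abc => a_gt0 le_ak /eqP-> lt_b sub_abc.
  (* The missing bound a < l comes from k + a < k + l. *)
  have [|s [gs sub]] := @wheel_growth a c a_gt0 le_ak _ lt_c; first by lia.
  by exists 0, s; split=> [||u /sub_abc /sub] //; lia.
have spoke_inj a b c : {subset [:: x; y; z] <= [:: a; b; c]} ->
    a < k + l -> b < k + l -> c < k + l ->
    [|| b == 0, b == a | spoke_color b != spoke_color a].
  move=> sub_abc lt_a lt_b lt_c.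
  have : ~~ clash a b by apply/negP => ?; apply: no_clash; exists a, b, c.
  have : ~~ clash b a.
    apply/negP => ?; apply: no_clash; exists b, a, c; split=> // u /sub_abc.
    by rewrite !inE; lia.
  by rewrite /clash /spoke_color; repeat case: ifP; lia.
have xy : [|| y == 0, y == x | spoke_color y != spoke_color x].
  by apply: (spoke_inj _ _ z).
have xz : [|| z == 0, z == x | spoke_color z != spoke_color x].
  by apply: (spoke_inj _ _ y) => // u; rewrite !inE; lia.
have yz : [|| z == 0, z == y | spoke_color z != spoke_color y].
  by apply: (spoke_inj _ _ x) => // u; rewrite !inE; lia.
exists 0, [:: (0, x); (0, y); (0, z)]; split; [lia | | by move=> u /=; rewrite !inE; lia].
rewrite /= !inE !wheel_color_hub !wheel_adj_hub lt_x lt_y lt_z; lia.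
Qed.

End Wheel.

(** * The graph K_{2,4} with parts {0, 1} and {2, 3, 4, 5}, for l = 3 *)

Definition K24_adj : rel nat := fun x y => (x < 2) (+) (y < 2).

(** The two lists color the edges from 0 and from 1 to 2, 3, 4, 5. *)
Definition K24_color x y :=
  nth 0 (if minn x y == 0 then [:: 1; 1; 2; 3] else [:: 2; 3; 1; 1]) (maxn x y - 2).

Lemma K24_adj_sym : symmetric K24_adj.
Proof. by move=> x y; rewrite /K24_adj addbC. Qed.

Lemma K24_adj_irr : irreflexive K24_adj.
Proof. by move=> x; rewrite /K24_adj addbb. Qed.

Lemma K24_color_sym x y : K24_color x y = K24_color y x.
Proof. by rewrite /K24_color minnC maxnC. Qed.

Lemma K24_color_bound x y : x < 6 -> y < 6 -> K24_adj x y -> 0 < K24_color x y <= 3.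
Proof. by move: x y; do 6?[case=> //]; do 6?[case=> //]. Qed.

(** The six vertex sets, of four elements each, cover all triples of {0, ..., 5}. *)
Definition K24_trees : seq (nat * seq (nat * nat)) :=
  [:: (0, [:: (0, 2); (0, 4); (0, 5)]); (0, [:: (0, 2); (2, 1); (1, 3)]);
      (0, [:: (0, 3); (0, 4); (0, 5)]); (0, [:: (0, 4); (0, 5); (4, 1)]);
      (1, [:: (1, 2); (1, 3); (1, 4)]); (1, [:: (1, 2); (1, 3); (1, 5)])].

Lemma K24_spans3 : spans3 6 K24_adj K24_color.
Proof.
move=> x y z lt_x lt_y lt_z.
have trees_ok : all (fun t => (t.1 < 6) && growth 6 K24_adj K24_color [:: t.1] [::] t.2)
  K24_trees by [].
have /allP/(_ x) : all (fun x => all (fun y => all (fun z =>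
    has (fun t => all (mem (t.1 :: unzip2 t.2)) [:: x; y; z]) K24_trees)
  (iota 0 6)) (iota 0 6)) (iota 0 6) by [].
rewrite mem_iota => /(_ lt_x) /allP/(_ y); rewrite mem_iota => /(_ lt_y) /allP/(_ z).
rewrite mem_iota => /(_ lt_z) /hasP[[v s] /(allP trees_ok) /andP[lt_v gs] /allP sub].
by exists v, s.
Qed.

(** * The upper bound from the two constructions *)

Theorem theorem2p12 (n l : nat) (n_gt0 : 0 < n) (l_gt0 : 0 < l)
  (le_n_2l : n <= 2 * l) (le_l_n3 : l + 3 <= n) :
  exists t : nat, is_t n 3 l t /\ t <= 2 * n - l - 1.
Proof.
have [l3|l_neq3] := eqVneq l 3.
  (* Both bounds on n equal 6, and K_{2,4} has 8 = 2 * 6 - 3 - 1 edges. *)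
  have -> : n = 6 by lia.
  rewrite l3.
  apply: (is_t_nat_graph K24_adj_sym K24_adj_irr K24_color_sym K24_spans3
    K24_color_bound (L := [seq (x, y) | x <- iota 0 2, y <- iota 2 4])).
  move=> x y lt_xy lt_y; rewrite /K24_adj => adj_xy.
  by rewrite allpairs_f // mem_iota; lia.
set k := n - l.
have def_n : n = k + l by rewrite /k; lia.
have [k_ge3 le_kl l_ge4] : [/\ 2 < k, k <= l & 3 < l] by rewrite /k; split; lia.
have [t [t_min t_le]] := is_t_nat_graph (wheel_adj_sym k) (wheel_adj_irr k)
  (wheel_color_sym k l) (wheel_spans3 k_ge3 le_kl l_ge4)
  (wheel_color_bound k_ge3 le_kl l_ge4) (wheel_edgesP k_ge3 le_kl l_ge4).
exists t; split; first by rewrite def_n.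
apply: leq_trans t_le _.
(* The count is 1 + (k+l-1) + (k-1) = 2k+l-1 = 2n-l-1. *)
by rewrite /= size_cat !size_map !size_iota; lia.
Qed.
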